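(* Let $\mathbf{A}\in\mathbb{H}^{n\times n}$ be a Hermitian quaternion matrix with $\mathrm{Ind}\,\mathbf{A}=k$ and $\operatorname{rank}\mathbf{A}^{k+1}=\operatorname{rank}\mathbf{A}^{k}=r\le n$ (with $r\ge 1$), and let $\mathbf{B}\in\mathbb{H}^{n\times m}$. Put $\hat{\mathbf{B}}=\mathbf{A}^{k}\mathbf{B}\in\mathbb{H}^{n\times m}$, with $j$th column $\hat{\mathbf{b}}_{.j}$. Then for the Drazin inverse solution $\mathbf{X}=\mathbf{A}^{D}\mathbf{B}=(x_{ij})\in\mathbb{H}^{n\times m}$ of the matrix equation $\mathbf{A}\mathbf{X}=\mathbf{B}$ we have, for all $i=1,\dots,n$ and $j=1,\dots,m$, $$x_{ij}=\frac{\sum_{\beta\in J_{r,n}\{i\}}\mathrm{cdet}_{i}\left(\left(\mathbf{A}^{k+1}\right)_{.i}\left(\hat{\mathbf{b}}_{.j}\right)\right)_{\beta}^{\beta}}{\sum_{\beta\in J_{r,n}}\left|\left(\mathbf{A}^{k+1}\right)_{\beta}^{\beta}\right|}.$$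
   Context: $\mathbb{H}$ is the skew field of real quaternions; $\mathbf{A}^{*}$ is the conjugate transpose and $\mathbf{A}$ is Hermitian if $\mathbf{A}^*=\mathbf{A}$. The rank of a quaternion matrix is the maximal number of right-linearly independent columns (equivalently, of left-linearly independent rows). Index and Drazin inverse: $\mathrm{Ind}\,\mathbf{A}$ is the least integer $k\ge 0$ with $\operatorname{rank}\mathbf{A}^{k+1}=\operatorname{rank}\mathbf{A}^{k}$ ($\mathbf{A}^0=\mathbf{I}$). For $k=\mathrm{Ind}\,\mathbf{A}$, the Drazin inverse $\mathbf{A}^D$ is the unique matrix $\mathbf{X}$ with $\mathbf{A}^{k+1}\mathbf{X}=\mathbf{A}^{k}$, $\mathbf{X}\mathbf{A}\mathbf{X}=\mathbf{X}$, $\mathbf{A}\mathbf{X}=\mathbf{X}\mathbf{A}$. The ''Drazin inverse solution'' of $\mathbf{A}\mathbf{X}=\mathbf{B}$ is by definition the matrix $\mathbf{A}^D\mathbf{B}$. Column determinants of $\mathbf{M}=(m_{pq})\in\mathbb{H}^{n\times n}$: given $j$, write each $\tau\in S_n$ as a product of disjoint cycles (including cycles of length one) $C_r\cdots C_2C_1$, each written as $C=(c_l\dots c_1\,c_0)$, where $C_1$ contains $j$ and has $c_0=j$ as last element, each $C_t$ with $t\ge2$ has its smallest element $c_0$ last, and these last elements increase with $t=2,\dots,r$. Set $m'_C=m_{c_0c_l}m_{c_lc_{l-1}}\cdots m_{c_1c_0}$. Then $\mathrm{cdet}_j\mathbf{M}=\sum_{\tau\in S_n}(-1)^{n-r}m'_{C_r}\cdots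 m'_{C_2}m'_{C_1}$, where $r=r(\tau)$ is the number of cycles. For a Hermitian matrix all column determinants coincide and are real; their common value is the determinant $\det\mathbf{M}=|\mathbf{M}|$. Notation: $\mathbf{M}_{.i}(\mathbf{b})$ is $\mathbf{M}$ with its $i$th column replaced by the column $\mathbf{b}$. $\mathbf{M}_\beta^\beta$ is the principal submatrix with rows and columns indexed by $\beta$; its rows and columns keep their original labels, so $\mathrm{cdet}_i(\mathbf{M}_\beta^\beta)$ ($i\in\beta$) refers to the column originally labelled $i$. For $1\le s\le n$, $J_{s,n}$ is the set of all strictly increasing sequences (subsets) of $s$ integers from $\{1,\dots,n\}$, and $J_{s,n}\{i\}$ is the subset of those containing $i$. *)

(* Defs.v *)
From HB Require Import structures.
From mathcomp Require Import all_boot all_order all_algebra all_fingroup.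
From mathcomp Require Import boolp classical_sets reals.
From mathcomp Require Import ring lra.

Set Implicit Arguments.
Unset Strict Implicit.
Unset Printing Implicit Defensive.
Import Order.TTheory GRing.Theory Num.Theory.
Local Open Scope ring_scope.

(* [Quat a b c d] is a + b i + c j + d k. *)
Record quat (R : realType) := Quat { qre : R; qi : R; qj : R; qk : R }.

Section QuatStructure.
Variable R : realType.
Implicit Types x y z : quat R.

Definition quat_tuple x := (qre x, qi x, qj x, qk x).
Definition tuple_quat (t : R * R * R * R) : quat R :=
  let: (a, b, c, d) := t in Quat a b c d.
Lemma quat_tupleK : cancel quat_tuple tuple_quat.
Proof. by case. Qed.

HB.instance Definition _ := Choice.copy (quat R) (can_type quat_tupleK).

Lemma quat_ext x y :
  qre x = qre y -> qi x = qi y -> qj x = qj y -> qk x = qk y -> x = y.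
Proof. by case: x y => [a b c d] [a' b' c' d'] /= -> -> -> ->. Qed.

Definition qzero : quat R := Quat 0 0 0 0.
Definition qone : quat R := Quat 1 0 0 0.
Definition qopp x := Quat (- qre x) (- qi x) (- qj x) (- qk x).
Definition qadd x y :=
  Quat (qre x + qre y) (qi x + qi y) (qj x + qj y) (qk x + qk y).
Definition qmul x y := Quat
  (qre x * qre y - qi x * qi y - qj x * qj y - qk x * qk y)
  (qre x * qi y + qi x * qre y + qj x * qk y - qk x * qj y)
  (qre x * qj y - qi x * qk y + qj x * qre y + qk x * qi y)
  (qre x * qk y + qi x * qj y - qj x * qi y + qk x * qre y).
Definition qconj x := Quat (qre x) (- qi x) (- qj x) (- qk x).
Definition qnormsq x := qre x ^+ 2 + qi x ^+ 2 + qj x ^+ 2 + qk x ^+ 2.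
Definition qinv x :=
  Quat (qre x / qnormsq x) (- qi x / qnormsq x)
       (- qj x / qnormsq x) (- qk x / qnormsq x).

Lemma qaddA : associative qadd.
Proof. by move=> x y z; apply: quat_ext => /=; ring. Qed.
Lemma qaddC : commutative qadd.
Proof. by move=> x y; apply: quat_ext => /=; ring. Qed.
Lemma qadd0 : left_id qzero qadd.
Proof. by move=> x; apply: quat_ext => /=; ring. Qed.
Lemma qaddN : left_inverse qzero qopp qadd.
Proof. by move=> x; apply: quat_ext => /=; ring. Qed.

HB.instance Definition _ :=
  GRing.isZmodule.Build (quat R) qaddA qaddC qadd0 qaddN.

Lemma qmulA : associative qmul.
Proof. by move=> x y z; apply: quat_ext => /=; ring. Qed.
Lemma qmul1l : left_id qone qmul.
Proof. by move=> x; apply: quat_ext => /=; ring. Qed.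
Lemma qmul1r : right_id qone qmul.
Proof. by move=> x; apply: quat_ext => /=; ring. Qed.
Lemma qmulDl : left_distributive qmul +%R.
Proof. by move=> x y z; apply: quat_ext => /=; ring. Qed.
Lemma qmulDr : right_distributive qmul +%R.
Proof. by move=> x y z; apply: quat_ext => /=; ring. Qed.
Lemma qone_neq0 : qone != 0.
Proof. by apply/eqP => -[] /eqP; rewrite oner_eq0. Qed.

HB.instance Definition _ := GRing.Zmodule_isNzRing.Build (quat R)
  qmulA qmul1l qmul1r qmulDl qmulDr qone_neq0.

Lemma qnormsq_neq0 x : x != 0 -> qnormsq x != 0.
Proof.
apply: contra_neq => h; rewrite /qnormsq in h.
have := (sqr_ge0 (qre x), sqr_ge0 (qi x), sqr_ge0 (qj x), sqr_ge0 (qk x)).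
move=> [[[h0 h1] h2] h3].
by apply: quat_ext => /=; apply/eqP; rewrite -sqrf_eq0; apply/eqP; lra.
Qed.

Definition qunit : pred (quat R) := [pred x | x != 0].

Lemma qmulVx : {in qunit, left_inverse 1 qinv *%R}.
Proof.
move=> x /qnormsq_neq0; rewrite /qnormsq => h.
by apply: quat_ext; rewrite /= /qnormsq; field.
Qed.
Lemma qmulxV : {in qunit, right_inverse 1 qinv *%R}.
Proof.
move=> x /qnormsq_neq0; rewrite /qnormsq => h.
by apply: quat_ext; rewrite /= /qnormsq; field.
Qed.
Lemma qunitP x y : y * x = 1 /\ x * y = 1 -> qunit x.
Proof.
move=> [h _]; apply/eqP => x0; move: h; rewrite x0 mulr0 => /eqP.
by rewrite eq_sym oner_eq0.
Qed.
Lemma qinv_out : {in [predC qunit], qinv =1 id}.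
Proof.
move=> x; rewrite inE /= /in_mem /= negbK => /eqP ->.
by apply: quat_ext; rewrite /= ?oppr0 mul0r.
Qed.

HB.instance Definition _ := GRing.NzRing_hasMulInverse.Build (quat R)
  qmulVx qmulxV qunitP qinv_out.

End QuatStructure.

Definition quat_of_real (R : realType) (a : R) : quat R := Quat a 0 0 0.

Section QuatMatrix.
Variable R : realType.
Local Notation H := (quat R).

Definition ctrmx m n (M : 'M[H]_(m, n)) : 'M[H]_(n, m) :=
  map_mx (@qconj R) M^T.

Definition is_hermitian n (M : 'M[H]_n) : Prop := ctrmx M = M.

Definition right_indep m n (M : 'M[H]_(m, n)) (S : {set 'I_n}) : Prop :=
  forall c : 'I_n -> H,
    (forall p, \sum_(q in S) M p q * c q = 0) -> forall q, q \in S -> c q = 0.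

Definition qrank m n (M : 'M[H]_(m, n)) : nat :=
  \max_(S : {set 'I_n} | `[< right_indep M S >]) #|S|.

Definition is_Ind n (M : 'M[H]_n) (k : nat) : Prop :=
  qrank (M ^+ k.+1) = qrank (M ^+ k) /\
  forall l, qrank (M ^+ l.+1) = qrank (M ^+ l) -> (k <= l)%N.

Definition is_drazin n (M X : 'M[H]_n) : Prop :=
  exists k, [/\ is_Ind M k, M ^+ k.+1 *m X = M ^+ k,
                X *m M *m X = X & M *m X = X *m M].

(* The unique matrix satisfying [is_drazin M]; the default 0 is irrelevant,
   since every square quaternion matrix has a Drazin inverse. *)
Definition drazin n (M : 'M[H]_n) : 'M[H]_n := xget 0 (is_drazin M).

(* For the cycle of t through c, the ordered product
   m_{c, t c} m_{t c, t^2 c} ... m_{t^l c, c}, where l + 1 is its length. *)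
Definition cycle_prod n (M : 'M[H]_n) (t : 'S_n) (c : 'I_n) : H :=
  \prod_(0 <= l < #|porbit t c|) M ((t ^+ l)%g c) ((t ^+ l.+1)%g c).

(* The minimal elements, in increasing order, of the cycles of t (fixed points
   included) that do not contain j. *)
Definition cycle_mins n (t : 'S_n) (j : 'I_n) : seq 'I_n :=
  [seq c <- enum 'I_n | (c \notin porbit t j) &&
                        [forall d in porbit t c, (c <= d)%N]].

Definition cdet n (j : 'I_n) (M : 'M[H]_n) : H :=
  \sum_(t : 'S_n) (-1) ^+ (n - #|porbits t|) *
    ((\prod_(c <- rev (cycle_mins t j)) cycle_prod M t c) * cycle_prod M t j).

(* The real number that is the common value of all the column determinants;
   it exists for Hermitian M, and is unique as soon as n > 0. *)
Definition hdet n (M : 'M[H]_n) : R :=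
  xget 0 (fun d : R => forall j, cdet j M = quat_of_real d).

Definition replace_col n (M : 'M[H]_n) (i : 'I_n) (b : 'cV[H]_n) : 'M[H]_n :=
  \matrix_(p, q) if q == i then b p ord0 else M p q.

Definition Jset s n : {set {ffun 'I_s -> 'I_n}} :=
  [set b : {ffun 'I_s -> 'I_n} |
     [forall p : 'I_s, forall q : 'I_s, (p < q)%N ==> (b p < b q)%N]].

Definition Jset_at s n (i : 'I_n) : {set {ffun 'I_s -> 'I_n}} :=
  [set b in Jset s n | i \in codom b].

Definition prinmx s n (M : 'M[H]_n) (b : {ffun 'I_s -> 'I_n}) : 'M[H]_s :=
  mxsub b b M.

(* [cdet] of the principal submatrix along the column whose original label is
   i; relabelling along the increasing b preserves the order of the indices.
   The value 0 is taken only when i does not occur in b. *)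
Definition cdet_prin s n (i : 'I_n) (M : 'M[H]_n) (b : {ffun 'I_s -> 'I_n}) : H :=
  if [pick p | b p == i] is Some p then cdet p (prinmx M b) else 0.

End QuatMatrix.

(* Main.v *)
(* For a set S of indices and i in S, collecting in the column determinant of
   the principal submatrix on S the permutations by the point j preceding i
   gives it as the sum over j of L_S(i,j) m_{ji}, where L_S(i,j) is a signed sum
   over paths from i to j.  Erasing the last point of the path yields
   L_S(i,j) = - sum_x L_{S\j}(i,x) m_{xj}, and L_S(i,i) = d(S\i).
   For Hermitian M these recursions give, by induction on S, L_S M = d(S) I with
   d(S) real: the off-diagonal entries cancel by the inductive hypothesis, and
   comparing the two ways of computing M L_S M gives
   delta_i m_ij = m_ij delta_j for the diagonal entries delta, which are
   therefore equal when m_ij is regular; this is arranged by adding an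
   indeterminate to all entries.
   Summing over the S of size s gives real numbers e_s (the sums of principal
   minors) and matrices L_s with L_{s+1} = e_s - L_s M and
   Re tr L_{s+1} = (n - s) e_s.  Let s be the largest index with e_s != 0.  Since
   L_{n+1} = 0, the recursion kills L_{s+1} M^(n-s), so L_{s+1} A = 0 as A is
   Hermitian, and L_{s+1} / e_s is a projection of trace n - s along the column
   space of M; hence s is the rank of M, and L_s A^k / e_s is the Drazin
   inverse of A when M = A^(k+1). *)
Require Import Defs.
From HB Require Import structures.
From mathcomp Require Import all_boot all_order all_algebra all_fingroup.
From mathcomp Require Import boolp classical_sets reals.
From mathcomp Require Import ring lra.
Set Implicit Arguments.
Unset Strict Implicit.
Unset Printing Implicit Defensive.
Import Order.TTheory GRing.Theory Num.Theory.
Local Open Scope ring_scope.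

(** * Signed sums over permutations and paths *)

Lemma sorted_enum_ord n : sorted (fun c d : 'I_n => (c < d)%N) (enum 'I_n).
Proof. by have := iota_ltn_sorted 0 n; rewrite -val_enum_ord sorted_map. Qed.

Section PermutationSums.
Variables (K : nzRingType) (n : nat).
Implicit Types (M : 'M[K]_n) (S : {set 'I_n}) (t : 'S_n) (i j c : 'I_n).

(** The length is left free: the full cycle length closes the cycle, one less leaves the open path
    ending at the predecessor of [c]. *)
Definition cycle_walk M t c l : K :=
  \prod_(0 <= u < l) M ((t ^+ u)%g c) ((t ^+ u.+1)%g c).

Definition min_of_cycle t c := [forall d in porbit t c, (c <= d)%N].

Definition cycle_leaders S t := [seq c <- enum 'I_n | (c \in S) && min_of_cycle t c].

Definition other_leaders S t i :=
  [seq c <- cycle_leaders S t | c \notin porbit t i].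

Definition cycles_prod M t (s : seq 'I_n) : K :=
  \prod_(c <- rev s) cycle_walk M t c #|porbit t c|.

(** Permutations of the whole index set supported in [S] stand for those of the principal submatrix,
    so [S] can vary without relabelling. *)
Definition sdet M S : K :=
  \sum_(t : 'S_n | perm_on S t) (-1) ^+ t * cycles_prod M t (cycle_leaders S t).

Definition sub_cdet M S i : K :=
  \sum_(t : 'S_n | perm_on S t)
    (-1) ^+ t * (cycles_prod M t (other_leaders S t i) * cycle_walk M t i #|porbit t i|).

(* The coefficient of the entry in row j of column i in [sub_cdet M S i]: the
   cycle through i is cut open into a path from i to j. *)
Definition path_det M S i j : K :=
  \sum_(t : 'S_n | perm_on S t && (t j == i))
    (-1) ^+ t *
    (cycles_prod M t (other_leaders S t i) * cycle_walk M t i #|porbit t i|.-1).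

Lemma permXS t l x : (t ^+ l.+1)%g x = t ((t ^+ l)%g x).
Proof. by rewrite expgSr permM. Qed.

Lemma permX_porbit t x : (t ^+ #|porbit t x|)%g x = x.
Proof. by rewrite permX iter_porbit. Qed.

Lemma permX_porbit_pred t x : (t ^+ #|porbit t x|.-1)%g x = (t^-1)%g x.
Proof.
apply: (@perm_inj _ t).
by rewrite -permXS prednK ?lt0n ?card_porbit_neq0 // permX_porbit permKV.
Qed.

Lemma perm_in_porbit t x y : (t y \in porbit t x) = (y \in porbit t x).
Proof.
by rewrite -!eq_porbit_mem; congr (_ == _); have := porbit_perm t 1 y; rewrite expg1.
Qed.

(** Permutations are grouped by [x], the predecessor of [i]; the entry [M x i] closes the cycle and
    is the last factor. *)
Lemma sub_cdet_expand M S i : i \in S ->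
  sub_cdet M S i = \sum_(x in S) path_det M S i x * M x i.
Proof.
move=> iS; rewrite /sub_cdet.
rewrite (partition_big (fun t : 'S_n => (t^-1)%g i) (mem S)) /=; last first.
  by move=> t tS; rewrite (perm_closed _ (perm_onV tS)).
apply: eq_bigr => x xS; rewrite /path_det mulr_suml.
apply: eq_big => [t|t /andP[tS /eqP tx]].
  by rewrite -(inj_eq (@perm_inj _ t)) permKV (eq_sym i).
rewrite -!mulrA; congr (_ * (_ * _)).
rewrite /cycle_walk -{1}[#|porbit t i|]prednK ?lt0n ?card_porbit_neq0 //.
by rewrite big_nat_recr //= permXS permX_porbit_pred tx -tx permKV.
Qed.

(** Both lists are strictly increasing, so equal membership suffices; the minimum of [S] always
    leads its cycle. *)
Lemma cycle_leaders_min S t i : i \in S -> (forall c, c \in S -> (i <= c)%N) ->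
  perm_on S t -> cycle_leaders S t = i :: other_leaders S t i.
Proof.
move=> iS imin tS.
have lt_trans : transitive (fun c d : 'I_n => (c < d)%N).
  by move=> b a c; apply: ltn_trans.
have sL := sorted_filter lt_trans (fun c => (c \in S) && min_of_cycle t c) (sorted_enum_ord n).
have orbS c : c \in porbit t i -> c \in S.
  case/porbitP => l ->; elim: l => [|l IH]; first by rewrite expg0 perm1.
  by rewrite permXS (perm_closed _ tS).
apply: (@irr_sorted_eq _ (fun c d : 'I_n => (c < d)%N)) => //.
- by move=> a; rewrite ltnn.
- rewrite /= (path_sortedE lt_trans); apply/andP; split; last first.
    exact: sorted_filter.
  apply/allP => c; rewrite !mem_filter => /andP[nci /andP[/andP[cS _] _]].
  rewrite ltn_neqAle imin // andbT; apply: contra nci => /eqP ic.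
  by have <- : i = c by [apply: val_inj]; exact: porbit_id.
- move=> c; have cE : c \in enum (ordinal n) by rewrite mem_enum.
  rewrite inE mem_filter cE mem_filter mem_filter cE !andbT.
  have [->|ci] /= := eqVneq c i.
    rewrite iS /=; apply/forall_inP => d /orbS; exact: imin.
  case cS: (c \in S) => /=; last by rewrite andbF.
  case mc: (min_of_cycle t c); rewrite ?andbF // andbT.
  symmetry; apply/negP => ci'; case/negP: ci; apply/eqP/val_inj/eqP.
  rewrite /= eqn_leq imin // andbT.
  by move/forall_inP: mc; apply; rewrite porbit_sym.
Qed.

Lemma sdet_min M S i : i \in S -> (forall c, c \in S -> (i <= c)%N) ->
  sdet M S = sub_cdet M S i.
Proof.
move=> iS imin; apply: eq_bigr => t tS; rewrite (cycle_leaders_min iS imin tS).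
by rewrite /cycles_prod rev_cons -cats1 big_cat big_seq1.
Qed.

Lemma sdet0 M : sdet M finset.set0 = 1.
Proof.
rewrite /sdet (big_pred1 1%g) => [|t]; last first.
  apply/idP/eqP => [t0|->]; last exact: perm_on1.
  by apply: (perm_on_id t0); rewrite cards0.
rewrite odd_perm1 mul1r /cycles_prod /cycle_leaders (_ : filter _ _ = [::]) ?big_nil //.
by apply/eqP; rewrite -(negbK (_ == _)) -has_filter; apply/hasPn => c _; rewrite inE.
Qed.

Lemma porbit_fix t i : t i = i -> porbit t i = [set i].
Proof.
move=> ti; apply/setP => c; rewrite inE; apply/idP/eqP => [/porbitP[l ->]|->].
  by elim: l => [|l IH]; rewrite ?expg0 ?perm1 // permXS IH.
exact: porbit_id.
Qed.

Lemma perm_on_setD1 S t i :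
  perm_on (S :\ i) t = perm_on S t && (t i == i).
Proof.
apply/idP/andP => [tS|[tS /eqP ti]].
  split; last by rewrite (out_perm tS) // !inE eqxx.
  exact: fintype.subset_trans tS (subD1set _ _).
apply/fintype.subsetP => x; rewrite inE => tx; rewrite !inE.
have -> : x \in S by apply: (fintype.subsetP tS); rewrite inE.
rewrite andbT.
by apply: contraNneq tx => ->; rewrite ti.
Qed.

Lemma path_det_diag M S i : path_det M S i i = sdet M (S :\ i).
Proof.
apply: eq_big => [t|t /andP[tS /eqP ti]]; first by rewrite perm_on_setD1.
rewrite /cycle_walk (porbit_fix ti) cards1 big_geq // mulr1.
congr (_ * cycles_prod _ _ _); rewrite /other_leaders /cycle_leaders.
rewrite -filter_predI; apply: eq_filter => c /=.
by rewrite porbit_fix // !inE andbA.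
Qed.

(** * Insertion of a fixed point at the end of a cycle *)

Section RemovePoint.
Variables (i j : 'I_n) (t : 'S_n).
Hypotheses (neq_ij : i != j) (tj : t j = j).
Local Notation t' := (t * tperm i j)%g.

Let other c : c != j -> c \notin porbit t i -> forall l, (t' ^+ l)%g c = (t ^+ l)%g c.
Proof.
move=> cj ci; elim=> [|l IH]; first by rewrite !expg0.
rewrite !permXS IH permM -permXS tpermD //.
  by apply: contra ci => /eqP ->; rewrite porbit_sym mem_porbit.
have tl : (t ^+ l.+1)%g j = j.
  by elim: l.+1 => [|u]; rewrite ?expg0 ?perm1 // permXS => ->.
apply: contra cj => /eqP h.
by rewrite -(inj_eq (@perm_inj _ (t ^+ l.+1)%g)) -h tl.
Qed.

Lemma porbit_insert_other c : c != j -> c \notin porbit t i -> porbit t' c = porbit t c.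
Proof.
move=> cj ci; apply/setP => d; apply/porbitP/porbitP => -[l ->]; exists l;
by rewrite other.
Qed.

Lemma cycle_walk_insert_other M c l : c != j -> c \notin porbit t i ->
  cycle_walk M t' c l = cycle_walk M t c l.
Proof. by move=> cj ci; apply: eq_bigr => u _; rewrite !other. Qed.

Let along l : (l < #|porbit t i|)%N -> (t' ^+ l)%g i = (t ^+ l)%g i.
Proof.
elim: l => [|l IH] hl; first by rewrite !expg0.
rewrite permXS IH ?(ltnW hl) // permM -permXS tpermD //.
  have hu := uniq_traject_porbit t i.
  have l1 : (l.+1 < size (traject t i #|porbit t i|))%N by rewrite size_traject.
  have l0 : (0 < size (traject t i #|porbit t i|))%N by rewrite size_traject (leq_ltn_trans _ hl).
  have := nth_uniq i l0 l1 hu; rewrite !nth_traject ?(leq_ltn_trans _ hl) //= permX /=.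
  by move=> ->.
apply: contraNneq neq_ij => h.
have: j \in porbit t i by rewrite h mem_porbit.
by rewrite porbit_sym porbit_fix // inE.
Qed.

Lemma permX_insert_last : (t' ^+ #|porbit t i|)%g i = j.
Proof.
rewrite -[#|porbit t i|]prednK ?lt0n ?card_porbit_neq0 // permXS.
rewrite along ?ltn_predL ?lt0n ?card_porbit_neq0 //.
by rewrite permX_porbit_pred permM permKV tpermL.
Qed.

Lemma porbit_insert : porbit t' i = j |: porbit t i.
Proof.
apply/setP => c; rewrite in_setU1; apply/idP/idP => [/porbitP[l ->]|].
  elim: l => [|l]; first by rewrite expg0 perm1 porbit_id orbT.
  rewrite permXS permM; move: ((t' ^+ l)%g i) => y /predU1P[-> {y}|hy].
    by rewrite tj tpermR porbit_id orbT.
  case: tpermP => [_|_|_ _]; rewrite ?eqxx ?porbit_id ?orbT //.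
  by rewrite perm_in_porbit hy orbT.
case/predU1P => [->|]; first by rewrite -{1}permX_insert_last mem_porbit.
rewrite porbit_traject => /trajectP[l hl ->].
by rewrite -permX -along // mem_porbit.
Qed.

Lemma card_porbit_insert : #|porbit t' i| = #|porbit t i|.+1.
Proof. by rewrite porbit_insert cardsU1 porbit_sym porbit_fix // inE neq_ij. Qed.

Lemma cycle_walk_insert M :
  cycle_walk M t' i #|porbit t i| =
  cycle_walk M t i #|porbit t i|.-1 * M ((t^-1)%g i) j.
Proof.
rewrite /cycle_walk -{1}[#|porbit t i|]prednK ?lt0n ?card_porbit_neq0 // big_nat_recr //=.
have lt0 : (0 < #|porbit t i|)%N by rewrite lt0n card_porbit_neq0.
congr (_ * _).
  apply: eq_big_nat => l /andP[_ hl]; rewrite !along //; first by rewrite -ltn_predRL.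
  by apply: ltn_trans hl _; rewrite ltn_predL.
by rewrite prednK // permX_insert_last along ?ltn_predL // permX_porbit_pred.
Qed.

Lemma other_leaders_insert S : other_leaders S t' i = other_leaders (S :\ j) t i.
Proof.
rewrite /other_leaders /cycle_leaders -!filter_predI; apply: eq_filter => c /=.
rewrite porbit_insert !inE negb_or.
have [->|cj] /= := eqVneq c j; first by rewrite andbF.
case ci: (c \in porbit t i) => //=; rewrite /min_of_cycle porbit_insert_other ?ci //.
Qed.

Lemma cycles_prod_insert M S :
  cycles_prod M t' (other_leaders S t' i) = cycles_prod M t (other_leaders (S :\ j) t i).
Proof.
rewrite other_leaders_insert /cycles_prod; rewrite [LHS]big_seq [RHS]big_seq.
apply: eq_bigr => c; rewrite mem_rev mem_filter => /andP[ci].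
rewrite mem_filter !inE => /andP[/andP[/andP[cj _] _] _].
by rewrite porbit_insert_other ?cycle_walk_insert_other.
Qed.

End RemovePoint.

(** Sending [t] to [t * tperm i j] maps the permutations of [S :\ j] bijectively to those of [S]
    with [j] going to [i]. It appends [j] to the path from [i], and the transposition gives the
    sign. *)
Lemma path_det_last M S i j : i != j -> i \in S -> j \in S ->
  path_det M S i j = - \sum_(x in S :\ j) path_det M (S :\ j) i x * M x j.
Proof.
move=> ij iS jS.
have insj t : ((t * tperm i j)%g j == i) = (t j == j).
  by rewrite permM -(inj_eq (@perm_inj _ (tperm i j)) (t j)) tpermR.
transitivity (- \sum_(t : 'S_n | perm_on (S :\ j) t)
   (-1) ^+ t * (cycles_prod M t (other_leaders (S :\ j) t i) *
     cycle_walk M t i #|porbit t i|.-1) * M ((t^-1)%g i) j).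
  rewrite /path_det (reindex_inj (mulIg (tperm i j))) -sumrN /=.
  apply: eq_big => [t|t].
    rewrite perm_on_setD1 insj; congr (_ && _); have tpS : perm_on S (tperm i j).
      apply: fintype.subset_trans (tperm_on i j) _; apply/fintype.subsetP => x.
      by rewrite !inE => /orP[] /eqP ->.
    apply/idP/idP => [h|h]; last exact: perm_onM.
    by rewrite -(mulgK (tperm i j) t) tpermV; apply: perm_onM.
  rewrite insj => /andP[_ /eqP tj].
  rewrite cycles_prod_insert // card_porbit_insert //= cycle_walk_insert //.
  rewrite odd_permM odd_tperm ij addbT signrN mulNr; congr (- _).
  by rewrite !mulrA.
rewrite (partition_big (fun t : 'S_n => (t^-1)%g i) (mem (S :\ j))) /=; last first.
  by move=> t tS; rewrite (perm_closed _ (perm_onV tS)) !inE ij.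
congr (- _); apply: eq_bigr => x xS; rewrite /path_det mulr_suml.
apply: eq_big => [t|t /andP[tS /eqP <-]] //.
by rewrite -(inj_eq (@perm_inj _ t)) permKV (eq_sym i).
Qed.

Lemma sdet_expand M S i : i \in S -> (forall c, c \in S -> (i <= c)%N) ->
  sdet M S = \sum_(x in S) path_det M S i x * M x i.
Proof. by move=> iS imin; rewrite (sdet_min _ iS imin) sub_cdet_expand. Qed.

Lemma set_min S : S != finset.set0 ->
  exists2 i, i \in S & forall c, c \in S -> (i <= c)%N.
Proof.
case/set0Pn => x xS; case: (@arg_minnP _ x (mem S) (@nat_of_ord n) xS) => i iS h.
by exists i.
Qed.

End PermutationSums.

Lemma cdetE (R : realType) n (j : 'I_n) (M : 'M[quat R]_n) :
  cdet j M = sub_cdet M [set: 'I_n] j.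
Proof.
apply: eq_big => [t|t _].
  by symmetry; apply/fintype.subsetP => x; rewrite inE.
congr (_ * (_ * _)).
  (* The parity of a permutation is that of [n] minus its number of cycles, a subtraction that is
     not truncated. *)
  rewrite -signr_odd oddB; first by rewrite /odd_perm card_ord.
  by rewrite -[X in (_ <= X)%N]card_ord; apply: leq_imset_card.
rewrite /cycles_prod; congr (bigop.body _ _ _).
congr rev; rewrite /other_leaders /cycle_leaders -filter_predI /cycle_mins.
by apply: eq_filter => c /=; rewrite inE.
Qed.

(** * Hermitian matrices over a ring with involution *)

Section HermitianRegular.
Variables (K : nzRingType) (conj : {additive K -> K}) (n : nat) (M : 'M[K]_n).
Hypothesis conjM : forall x y, conj (x * y) = conj y * conj x.
Hypothesis conj1 : conj 1 = 1.
Hypothesis conj_central : forall x, conj x = x -> forall y, x * y = y * x.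
Hypothesis hermM : forall i j, conj (M i j) = M j i.
Hypothesis regM : forall i j, i != j -> forall x, x * M i j = 0 -> x = 0.
Implicit Types (S : {set 'I_n}) (i j : 'I_n).

(** The four claims share one induction because their proofs use one another on smaller sets. The
    third mirrors [path_det_last], erasing the first point of the path instead of the last. *)
Definition hermitian_cofactors S : Prop :=
  [/\ conj (sdet M S) = sdet M S,
      forall i j, i \in S -> j \in S -> conj (path_det M S i j) = path_det M S j i,
      forall i j, i != j -> i \in S -> j \in S ->
        path_det M S i j = - \sum_(x in S :\ i) M i x * path_det M (S :\ i) x j
    & forall i j, i \in S -> j \in S ->
        \sum_(x in S) path_det M S i x * M x j = if i == j then sdet M S else 0].

Section InductionStep.
Variable S : {set 'I_n}.
Hypothesis IH : forall T : {set 'I_n}, T \proper S -> hermitian_cofactors T.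

Let IHD1 i : i \in S -> hermitian_cofactors (S :\ i).
Proof. by move=> iS; apply: IH; rewrite properD1. Qed.

(** Erasing both end points turns either side into the same double sum over [S :\ j :\ i], apart
    from the direct edge [M i j], whose cofactor is central. *)
Lemma path_det_first_step i j : i != j -> i \in S -> j \in S ->
  path_det M S i j = - \sum_(x in S :\ i) M i x * path_det M (S :\ i) x j.
Proof.
move=> ij iS jS; rewrite path_det_last //; congr (- _).
have iSj : i \in S :\ j by rewrite !inE ij.
have jSi : j \in S :\ i by rewrite !inE eq_sym ij.
have [c1 _ f1 _] := IHD1 jS; have [c2 _ f2 _] := IHD1 iS.
rewrite [LHS](big_setD1 i) // [RHS](big_setD1 j) //= !path_det_diag.
have -> : S :\ i :\ j = S :\ j :\ i by rewrite !finset.setDDl finset.setUC.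
have [c0 _ _ _] : hermitian_cofactors (S :\ j :\ i).
  apply: IH; apply: proper_sub_trans (properD1 iSj) _; exact: subD1set.
rewrite (conj_central c0); congr (_ + _).
transitivity (- \sum_(x in S :\ j :\ i) \sum_(y in S :\ j :\ i)
   M i y * path_det M (S :\ j :\ i) y x * M x j).
  rewrite -sumrN; apply: eq_bigr => x; rewrite !inE => /and3P[xi xj xS].
  rewrite f1 ?inE ?ij ?xj ?xS // 1?eq_sym // mulNr; congr (- _).
  by rewrite mulr_suml.
rewrite exchange_big /= -sumrN; apply: eq_bigr => x; rewrite !inE => /and3P[xi xj xS].
rewrite (path_det_last _ xj) ?inE ?xi ?xS // 1?eq_sym ?ij // mulrN mulr_sumr.
have -> : S :\ i :\ j = S :\ j :\ i by rewrite !finset.setDDl finset.setUC.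
by congr (- _); apply: eq_bigr => y _; rewrite mulrA.
Qed.

(** Conjugation reverses products, exchanging the last-point and first-point recursions. *)
Lemma conj_path_det i j : i \in S -> j \in S ->
  conj (path_det M S i j) = path_det M S j i.
Proof.
move=> iS jS; have [<-|ij] := eqVneq i j.
  by rewrite path_det_diag; have [] := IHD1 iS.
rewrite path_det_last // (path_det_first_step _ jS iS) 1?eq_sym // raddfN raddf_sum /=.
congr (- _); apply: eq_bigr => x xS; rewrite conjM hermM.
by have [_ -> //] := IHD1 jS; rewrite !inE ij.
Qed.

(** For [i] in [S] this is the column determinant [sub_cdet M S i]; the aim is its independence of
    [i]. *)
Definition diag_cofactor i := \sum_(x in S) path_det M S i x * M x i.

Lemma expand_first_step i j : i \in S -> j \in S ->
  \sum_(x in S) path_det M S i x * M x j =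
  sdet M (S :\ i) * M i j -
  \sum_(y in S :\ i) M i y * \sum_(x in S :\ i) path_det M (S :\ i) y x * M x j.
Proof.
move=> iS jS; rewrite (big_setD1 i) //= path_det_diag; congr (_ + _).
under [in RHS]eq_bigr do rewrite mulr_sumr.
rewrite exchange_big -sumrN /=; apply: eq_bigr => x; rewrite !inE => /andP[xi xS].
rewrite (path_det_first_step _ iS xS) 1?eq_sym // mulNr mulr_suml.
by congr (- _); apply: eq_bigr => y _; rewrite mulrA.
Qed.

(** By induction only [y = j] survives in [expand_first_step], leaving [d * M i j - M i j * d] with
    [d = sdet M (S :\ i)] central. *)
Lemma expand_other_column i j : i != j -> i \in S -> j \in S ->
  \sum_(x in S) path_det M S i x * M x j = 0.
Proof.
move=> ij iS jS; rewrite expand_first_step //.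
have [c0 _ _ e] := IHD1 iS; have jSi : j \in S :\ i by rewrite !inE eq_sym ij.
rewrite (big_setD1 j) //= e // eqxx [X in _ - (_ + X)]big1 => [|y /setD1P[yj yS]].
  by rewrite addr0 (conj_central c0) subrr.
by rewrite e // (negbTE yj) mulr0.
Qed.

Lemma conj_diag_cofactor i : i \in S -> conj (diag_cofactor i) = diag_cofactor i.
Proof.
move=> iS; have [c0 h _ _] := IHD1 iS.
rewrite /diag_cofactor expand_first_step // raddfB conjM c0 hermM.
rewrite (conj_central c0) /=; congr (_ - _).
rewrite raddf_sum /=; under eq_bigr do rewrite conjM raddf_sum mulr_suml.
under [RHS]eq_bigr do rewrite mulr_sumr.
rewrite exchange_big /=; apply: eq_bigr => x xS; apply: eq_bigr => y yS.
by rewrite conjM !hermM h // mulrA.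
Qed.

(* Both sides, times the entry (i, j), compute the (i, j) entry of M L M, where
   L is the matrix of the [path_det M S]. *)
Lemma diag_cofactor_const i j : i \in S -> j \in S -> diag_cofactor i = diag_cofactor j.
Proof.
move=> iS jS; have [-> //|ij] := eqVneq i j.
have ML a b : a \in S -> b \in S ->
    \sum_(x in S) M a x * path_det M S x b = if a == b then diag_cofactor a else 0.
  move=> aS bS; transitivity (conj (\sum_(x in S) path_det M S b x * M x a)).
    rewrite raddf_sum /=; apply: eq_bigr => x xS.
    by rewrite conjM hermM conj_path_det.
  have [->|ab] := eqVneq a b; first exact: conj_diag_cofactor.
  by rewrite expand_other_column 1?eq_sym // raddf0.
have LM a b : a \in S -> b \in S ->
    \sum_(x in S) path_det M S a x * M x b = if a == b then diag_cofactor a else 0.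
  by move=> aS bS; have [->|ab] := eqVneq a b => //; rewrite expand_other_column.
have E : diag_cofactor i * M i j = M i j * diag_cofactor j.
  transitivity (\sum_(y in S) \sum_(x in S) M i x * path_det M S x y * M y j).
    rewrite (bigD1 i) //= [X in _ + X]big1 => [|y /andP[yS yi]].
      by rewrite -mulr_suml ML // eqxx addr0.
    by rewrite -mulr_suml ML // eq_sym (negbTE yi) mul0r.
  rewrite exchange_big /= (bigD1 j) //= [X in _ + X]big1 => [|y /andP[yS yj]].
    rewrite addr0; under eq_bigr do rewrite -mulrA.
    by rewrite -mulr_sumr LM // eqxx.
  under eq_bigr do rewrite -mulrA.
  by rewrite -mulr_sumr LM // (negbTE yj) mulr0.
(* By [E] and centrality, the difference of the two values annihilates the regular entry [M i j]. *)
apply/eqP; rewrite -subr_eq0; apply/eqP/(regM ij).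
by rewrite mulrBl E (conj_central (conj_diag_cofactor jS)) subrr.
Qed.

Lemma diag_cofactor_sdet i : i \in S -> diag_cofactor i = sdet M S.
Proof.
move=> iS; have [|m mS mmin] := @set_min _ S; first by apply/set0Pn; exists i.
by rewrite (sdet_expand _ mS mmin) (diag_cofactor_const iS mS).
Qed.

Lemma hermitian_cofactors_step : hermitian_cofactors S.
Proof.
split; [|exact: conj_path_det|exact: path_det_first_step|].
  have [->|/set0Pn[i iS]] := eqVneq S finset.set0.
    by rewrite sdet0.
  by rewrite -(diag_cofactor_sdet iS) conj_diag_cofactor.
move=> i j iS jS; have [<-|ij] := eqVneq i j; first exact: diag_cofactor_sdet.
exact: expand_other_column.
Qed.

End InductionStep.

Lemma hermitian_cofactorsP S : hermitian_cofactors S.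
Proof.
have [m] := ubnP #|S|; elim: m S => // m IHm S /ltnSE hS.
apply: hermitian_cofactors_step => T /proper_card TS.
by apply: IHm; apply: leq_trans TS hS.
Qed.

End HermitianRegular.

(** * Removal of the regularity hypothesis by an indeterminate *)

Section Perturbation.
Variables (K : nzRingType) (conj : {additive K -> K}) (n : nat) (M : 'M[K]_n).
Hypothesis conjM : forall x y, conj (x * y) = conj y * conj x.
Hypothesis conjK : involutive conj.
Hypothesis conj_central : forall x, conj x = x -> forall y, x * y = y * x.
Hypothesis hermM : forall i j, conj (M i j) = M j i.

Lemma conj_fix1 : conj 1 = 1.
Proof. by have := conjM 1 (conj 1); rewrite mul1r conjK mul1r. Qed.

Definition conjp (p : {poly K}) : {poly K} := map_poly conj p.

Lemma coef_conjp p l : (conjp p)`_l = conj p`_l.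
Proof. by rewrite coef_map_id0 ?raddf0. Qed.

Lemma conjp_is_additive : zmod_morphism conjp.
Proof. by move=> p q; apply/polyP => l; rewrite coefB !coef_conjp coefB raddfB. Qed.

HB.instance Definition _ := GRing.isZmodMorphism.Build _ _ conjp conjp_is_additive.

Lemma conjpM p q : conjp (p * q) = conjp q * conjp p.
Proof.
apply/polyP => l; rewrite coef_conjp coefM coefMr raddf_sum.
by apply: eq_bigr => u _; rewrite conjM !coef_conjp.
Qed.

Lemma conjp1 : conjp 1 = 1.
Proof.
apply/polyP => l; rewrite coef_conjp coef1.
by case: (l == 0)%N; rewrite ?raddf0 ?conj_fix1.
Qed.

Lemma conjp_central p : conjp p = p -> forall q, p * q = q * p.
Proof.
move=> hp q; apply/polyP => l; rewrite coefM coefMr; apply: eq_bigr => u _.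
by apply: conj_central; rewrite -coef_conjp hp.
Qed.

(* Adding the indeterminate to every entry makes the entries regular, and
   evaluating at 0 recovers M. *)
Definition perturb : 'M[{poly K}]_n := \matrix_(i, j) ('X + (M i j)%:P).

Lemma perturb_herm i j : conjp (perturb i j) = perturb j i.
Proof.
apply/polyP => l; rewrite coef_conjp !mxE !coefD !coefX !coefC raddfD /=.
congr (_ + _); first by case: (l == 1)%N; rewrite ?raddf0 ?conj_fix1.
by case: (l == 0)%N; rewrite ?raddf0.
Qed.

(** The entry is monic, and monic polynomials are regular over any ring. *)
Lemma perturb_reg i j x : x * perturb i j = 0 -> x = 0.
Proof.
rewrite mxE => /eqP h; apply/eqP.
by rewrite -(mulIr_eq0 x (monic_rreg (monicXaddC (M i j)))).
Qed.

(** The constant coefficient is a ring morphism even over a noncommutative ring, so it passes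
    through the signed sums. *)
Lemma coef0_cofactors S :
  sdet M S = (sdet perturb S)`_0 /\
  forall i j, path_det M S i j = (path_det perturb S i j)`_0.
Proof.
have E i j : (perturb i j)`_0 = M i j by rewrite mxE coefD coefX coefC add0r.
have W t c l : (cycle_walk perturb t c l)`_0 = cycle_walk M t c l.
  by rewrite -[LHS]/(coefp 0 _) rmorph_prod; apply: eq_bigr => u _ /=; rewrite E.
have C t s : (cycles_prod perturb t s)`_0 = cycles_prod M t s.
  by rewrite -[LHS]/(coefp 0 _) rmorph_prod; apply: eq_bigr => u _ /=; rewrite W.
split=> [|i j]; rewrite -[RHS]/(coefp 0 _) rmorph_sum; apply: eq_bigr => t _;
by rewrite !rmorphM rmorph_sign /= !(C, W).
Qed.

Lemma herm_cofactors S :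
  conj (sdet M S) = sdet M S /\
  forall i j, i \in S -> j \in S ->
    \sum_(x in S) path_det M S i x * M x j = if i == j then sdet M S else 0.
Proof.
have [c _ _ e] := hermitian_cofactorsP conjpM conjp1 conjp_central perturb_herm
  (fun i j _ => @perturb_reg i j) S.
have [d p] := coef0_cofactors S; split.
  by rewrite d -coef_conjp c.
move=> i j iS jS; have := congr1 (coefp 0) (e i j iS jS); rewrite rmorph_sum /=.
rewrite (fun_if (fun q : {poly K} => q`_0)) coef0 -d => <-.
apply: eq_bigr => x _; rewrite p -[RHS]/(coefp 0 _) rmorphM /=; congr (_ * _).
by rewrite mxE coefD coefX coefC add0r.
Qed.

End Perturbation.

(** * Sums of principal minors *)

Section Relabel.
Variables (K : nzRingType) (s n : nat) (f : 'I_s -> 'I_n).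
Hypothesis f_mono : forall p q : 'I_s, (p < q)%N -> (f p < f q)%N.
Implicit Types (N : 'M[K]_s) (M : 'M[K]_n) (S : {set 'I_s}).

Lemma mono_ord_inj : injective f.
Proof.
move=> p q fpq; have pq := @f_mono p q; have qp := @f_mono q p.
apply/val_inj; move: pq qp; rewrite fpq ltnn /=.
by case: (ltngtP p q) => // _; [move=> /(_ isT)|move=> _ /(_ isT)].
Qed.

Lemma mono_ord_le (p q : 'I_s) : (p <= q)%N -> (f p <= f q)%N.
Proof. by rewrite leq_eqVlt => /predU1P[/val_inj ->//|pq]; apply/ltnW/f_mono. Qed.

Let imD1 S i : f @: (S :\ i) = f @: S :\ f i.
Proof.
apply/setP => x; rewrite !inE; apply/imsetP/andP.
  case=> y; rewrite !inE => /andP[yi yS] ->.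
  by rewrite (inj_eq mono_ord_inj) yi imset_f.
by case=> xi /imsetP[y yS xy]; exists y; rewrite // !inE yS andbT -(inj_eq mono_ord_inj) -xy.
Qed.

Let sdet_relabel_of N M S :
  (forall i j, i \in S -> j \in S ->
    (forall x y, x \in S -> y \in S -> y != i -> N x y = M (f x) (f y)) ->
    path_det N S i j = path_det M (f @: S) (f i) (f j)) ->
  (forall x y, x \in S -> y \in S -> N x y = M (f x) (f y)) ->
  sdet N S = sdet M (f @: S).
Proof.
move=> H NM; have [->|/set_min[m mS mmin]] := eqVneq S finset.set0.
  by rewrite imset0 !sdet0.
rewrite (sdet_expand _ mS mmin) (@sdet_expand _ _ _ _ (f m)) ?imset_f //; last first.
  by move=> _ /imsetP[x xS ->]; apply/mono_ord_le/mmin.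
rewrite big_imset /=; last by move=> x y _ _; apply: mono_ord_inj.
by apply: eq_bigr => x xS; rewrite NM // H // => u v uS vS _; apply: NM.
Qed.

(** A path from [i] never returns to [i], so entries of column [i] do not occur and [N] may differ
    there; this will allow a replaced column. *)
Lemma path_det_relabel N M S i j : i \in S -> j \in S ->
  (forall x y, x \in S -> y \in S -> y != i -> N x y = M (f x) (f y)) ->
  path_det N S i j = path_det M (f @: S) (f i) (f j).
Proof.
have [m] := ubnP #|S|; elim: m S i j => // m IH S i j hS iS jS NM.
have cD a : a \in S -> (#|S :\ a| < m)%N.
  by move=> aS; move: hS; rewrite (cardsD1 a) aS.
have [<-|ij] := eqVneq i j.
  rewrite !path_det_diag -imD1; apply: sdet_relabel_of.
    by move=> a b; apply: IH; apply: cD.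
  by move=> x y /setD1P[_ xS] /setD1P[yi yS]; apply: NM.
rewrite path_det_last // (path_det_last _ (_ : f i != f j)) ?imset_f //; last first.
  by rewrite (inj_eq mono_ord_inj).
rewrite -imD1 big_imset /=; last by move=> x y _ _; apply: mono_ord_inj.
congr (- _); apply: eq_bigr => x xSj; move/setD1P: (xSj) => [xj xS].
rewrite NM // 1?eq_sym // IH ?cD //; first by rewrite !inE ij.
by move=> u v; rewrite !inE => /andP[_ uS] /andP[_ vS]; apply: NM.
Qed.

Lemma sdet_relabel N M S :
  (forall x y, x \in S -> y \in S -> N x y = M (f x) (f y)) ->
  sdet N S = sdet M (f @: S).
Proof. by apply: sdet_relabel_of => i j iS jS; apply: path_det_relabel. Qed.

End Relabel.

Lemma sum_setD1 (V : nmodType) (T : finType) (P : pred {set T})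
    (F : {set T} -> V) (i : T) :
  \sum_(S : {set T} | (i \in S) && P (S :\ i)) F (S :\ i) =
  \sum_(S : {set T} | (i \notin S) && P S) F S.
Proof.
rewrite (reindex_onto (fun S : {set T} => i |: S) (fun S => S :\ i)) /=; last first.
  by move=> S /andP[iS _]; rewrite finset.setD1K.
apply: eq_big => [S|S]; last by case/andP=> [_ /eqP ->].
rewrite setU11 /=; have [iS|iS] := boolP (i \in S).
  by apply/negbTE/nandP; right; apply/eqP => h; move: iS; rewrite -h !inE eqxx.
by rewrite finset.setU1K // eqxx andbT.
Qed.

Section MinorSums.
Variables (K : nzRingType) (conj : {additive K -> K}) (n : nat) (M : 'M[K]_n).
Hypothesis conjM : forall x y, conj (x * y) = conj y * conj x.
Hypothesis conjK : involutive conj.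
Hypothesis conj_central : forall x, conj x = x -> forall y, x * y = y * x.
Hypothesis hermM : forall i j, conj (M i j) = M j i.

Definition minor_sum s : K := \sum_(S : {set 'I_n} | #|S| == s) sdet M S.

(** The membership conditions matter: for [i] outside [S], [path_det M S i i] is [sdet M S], which
    need not be 0. *)
Definition adj_sum s : 'M[K]_n := \matrix_(i, j)
  \sum_(S : {set 'I_n} | [&& #|S| == s, i \in S & j \in S]) path_det M S i j.

Lemma conj_minor_sum s : conj (minor_sum s) = minor_sum s.
Proof.
rewrite raddf_sum; apply: eq_bigr => S _.
by have [] := herm_cofactors conjM conjK conj_central hermM S.
Qed.

Lemma minor_sum0 : minor_sum 0 = 1.
Proof.
by rewrite /minor_sum (big_pred1 finset.set0) ?sdet0 // => S; rewrite cards_eq0.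
Qed.

Lemma adj_sum0 : adj_sum 0 = 0.
Proof.
apply/matrixP => i j; rewrite !mxE big_pred0 // => S.
by apply/negP => /and3P[]; rewrite cards_eq0 => /eqP ->; rewrite inE.
Qed.

Lemma adj_sum_max : adj_sum n.+1 = 0.
Proof.
apply/matrixP => i j; rewrite !mxE big_pred0 // => S.
have hS : (#|S| <= n)%N by rewrite -[X in (_ <= X)%N]card_ord max_card.
by rewrite ltn_eqF.
Qed.

Lemma adj_sum_diag s i :
  adj_sum s.+1 i i = \sum_(S : {set 'I_n} | (i \notin S) && (#|S| == s)) sdet M S.
Proof.
rewrite mxE -sum_setD1; apply: eq_big => [S|S _]; last by rewrite path_det_diag.
by case iS: (i \in S); rewrite ?andbF // !andbT (cardsD1 i) iS.
Qed.

(** Each set of size [s] is counted once for every point outside it. *)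
Lemma mxtrace_adj_sum s : \tr (adj_sum s.+1) = minor_sum s *+ (n - s).
Proof.
rewrite /mxtrace; under eq_bigr do rewrite adj_sum_diag.
rewrite (exchange_big_dep (fun S : {set 'I_n} => #|S| == s)) /=; last by move=> i S _ /andP[].
rewrite /minor_sum -sumrMnl; apply: eq_bigr => S /eqP hS.
rewrite (eq_bigl (mem (~: S))); last by move=> i; rewrite /= inE hS eqxx andbT.
rewrite sumr_const; congr (_ *+ _).
by rewrite cardsCs finset.setCK hS card_ord.
Qed.

Lemma mul_adj_sum s i j :
  (adj_sum s *m M) i j = \sum_(S : {set 'I_n} | (#|S| == s) && (i \in S))
     \sum_(x in S) path_det M S i x * M x j.
Proof.
rewrite mxE; under eq_bigr do rewrite mxE mulr_suml.
rewrite (exchange_big_dep (fun S : {set 'I_n} => (#|S| == s) && (i \in S))) /=; last first.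
  by move=> x S _ /and3P[-> ->].
apply: eq_bigr => S /andP[-> ->]; exact: eq_bigl.
Qed.

(* The Faddeev-LeVerrier recursion for the coefficients of the adjugate of
   'X + M. *)
Lemma adj_sumS s : adj_sum s.+1 = (minor_sum s)%:M - adj_sum s *m M.
Proof.
apply/matrixP => i j; rewrite [RHS]mxE [X in X + _]mxE [X in _ + X]mxE mul_adj_sum.
have E S := proj2 (herm_cofactors conjM conjK conj_central hermM S).
have [<-|ij] := eqVneq i j.
  (* On the diagonal the sets containing [i] cancel against the product with [M]. *)
  rewrite adj_sum_diag mulr1n /minor_sum [X in X - _](bigID (fun S : {set 'I_n} => i \in S)) /=.
  rewrite addrAC -[LHS]add0r; congr (_ + _); last by apply: eq_bigl => S; rewrite andbC.
  apply/esym/eqP; rewrite subr_eq0; apply/eqP/eq_bigr => S /andP[_ iS].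
  by rewrite E // eqxx.
(* Off the diagonal the sets containing [j] contribute 0; the others give [path_det_last] after [j]
   is added. *)
rewrite mulr0n add0r [X in - X](bigID (fun S : {set 'I_n} => j \in S)) /=.
rewrite big1 ?add0r => [|S /andP[/andP[_ iS] jS]]; last by rewrite E // (negbTE ij).
rewrite mxE -sumrN.
rewrite [RHS](eq_bigl (fun S : {set 'I_n} =>
  (j \notin S) && ((#|S| == s) && (i \in S)))); last first.
  by move=> S; rewrite andbC.
rewrite -(sum_setD1 (fun S : {set 'I_n} => (#|S| == s) && (i \in S))
  (fun S => - \sum_(x in S) path_det M S i x * M x j) j).
apply: eq_big => [S|S /and3P[_ iS jS]]; last exact: path_det_last.
rewrite !inE ij /=; case jS: (j \in S); rewrite ?andbF //= andbT.
by rewrite (cardsD1 j) jS.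
Qed.

Lemma scalar_mx_fixedC (a : K) (Y : 'M[K]_n) : conj a = a -> Y *m a%:M = a%:M *m Y.
Proof.
move=> ha; rewrite mul_scalar_mx; apply/matrixP => i j; rewrite !mxE.
rewrite (bigD1 j) //= big1 => [|x xj]; last by rewrite !mxE (negbTE xj) mulr0.
by rewrite !mxE eqxx addr0 (conj_central ha).
Qed.

(** By the recursion, [adj_sum s] is a polynomial in [M] with central coefficients. *)
Lemma adj_sum_comm (Y : 'M[K]_n) : Y *m M = M *m Y ->
  forall s, adj_sum s *m Y = Y *m adj_sum s.
Proof.
move=> YM; elim=> [|s IH]; first by rewrite adj_sum0 mul0mx mulmx0.
rewrite adj_sumS mulmxBl mulmxBr scalar_mx_fixedC ?conj_minor_sum //.
by rewrite mulmxA -IH -!mulmxA YM.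
Qed.

End MinorSums.

(** * Quaternion matrices and their rank *)

Section Quaternions.
Variable R : realType.
Local Notation H := (quat R).

Lemma qconj_is_additive : zmod_morphism (@qconj R).
Proof. by move=> x y; apply: quat_ext => /=; ring. Qed.
HB.instance Definition _ := GRing.isZmodMorphism.Build H H (@qconj R) qconj_is_additive.

Lemma qre_is_additive : zmod_morphism (@qre R).
Proof. by []. Qed.
HB.instance Definition _ := GRing.isZmodMorphism.Build H R (@qre R) qre_is_additive.

Lemma quat_of_real_is_additive : zmod_morphism (@quat_of_real R).
Proof. by move=> x y; apply: quat_ext => /=; ring. Qed.
HB.instance Definition _ :=
  GRing.isZmodMorphism.Build R H (@quat_of_real R) quat_of_real_is_additive.

Lemma qconjM (x y : H) : qconj (x * y) = qconj y * qconj x.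
Proof. by apply: quat_ext => /=; ring. Qed.

Lemma qconjK : involutive (@qconj R).
Proof. by move=> x; apply: quat_ext => /=; ring. Qed.

Lemma qconj_fixed (x : H) : qconj x = x -> x = quat_of_real (qre x).
Proof. by case: x => a b c d [] *; apply: quat_ext => //=; lra. Qed.

Lemma qconj_real (a : R) : qconj (quat_of_real a) = quat_of_real a.
Proof. by apply: quat_ext => //=; ring. Qed.

Lemma qconj_central (x : H) : qconj x = x -> forall y, x * y = y * x.
Proof. by move/qconj_fixed => -> y; apply: quat_ext => /=; ring. Qed.

Lemma qre_mulC (x y : H) : qre (x * y) = qre (y * x).
Proof. by rewrite /=; ring. Qed.

Lemma qre_real_mul (a : R) (y : H) : qre (quat_of_real a * y) = a * qre y.
Proof. by rewrite /=; ring. Qed.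

Lemma qre_mul_conj (x : H) : qre (x * qconj x) = qnormsq x.
Proof. by rewrite /= /qnormsq; ring. Qed.

Lemma qnormsq_ge0 (x : H) : 0 <= qnormsq x.
Proof. by rewrite !addr_ge0 ?sqr_ge0. Qed.

Lemma qnormsq_eq0 (x : H) : qnormsq x = 0 -> x = 0.
Proof. by move=> h; apply/eqP; apply: contra_eqT h => /qnormsq_neq0. Qed.

Lemma quat_of_real_eq0 (a : R) : (quat_of_real a == 0) = (a == 0).
Proof. by apply/eqP/eqP => [[]|->]. Qed.

Lemma quat_of_realV (a : R) : (quat_of_real a)^-1 = quat_of_real a^-1.
Proof.
have [->|a0] := eqVneq a 0; first by rewrite !(invr0, raddf0).
have ua : quat_of_real a \is a GRing.unit by rewrite -[_ \is a _]/(_ != 0) quat_of_real_eq0.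
apply: (mulrI ua); rewrite mulrV //.
by apply: quat_ext => /=; rewrite ?(mulr0, mul0r, subr0, addr0) // divff.
Qed.

Lemma ctrmxM m n p (Y : 'M[H]_(m, n)) (Z : 'M[H]_(n, p)) :
  ctrmx (Y *m Z) = ctrmx Z *m ctrmx Y.
Proof.
apply/matrixP => i j; rewrite !mxE raddf_sum /=; apply: eq_bigr => x _.
by rewrite qconjM !mxE.
Qed.

Lemma ctrmx_mul_eq0 m n (Y : 'M[H]_(m, n)) : Y *m ctrmx Y = 0 -> Y = 0.
Proof.
move=> h; apply/matrixP => i j; rewrite mxE; apply: qnormsq_eq0.
have : \sum_x qnormsq (Y i x) = 0.
  transitivity (qre ((Y *m ctrmx Y) i i)); last by rewrite h mxE.
  by rewrite mxE raddf_sum; apply: eq_bigr => x _ /=; rewrite !mxE -qre_mul_conj.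
by move/psumr_eq0P; apply=> // x _; apply: qnormsq_ge0.
Qed.

(** The quaternionic trace is not invariant under cyclic exchange of factors; its real part is. *)
Definition retrace n (Y : 'M[H]_n) : R := qre (\tr Y).

Lemma retraceB n (Y Z : 'M[H]_n) : retrace (Y - Z) = retrace Y - retrace Z.
Proof. by rewrite /retrace !raddfB. Qed.

Lemma retrace_mulC m n (Y : 'M[H]_(m, n)) (Z : 'M[H]_(n, m)) :
  retrace (Y *m Z) = retrace (Z *m Y).
Proof.
rewrite /retrace /mxtrace !raddf_sum /=.
under eq_bigr do rewrite mxE raddf_sum /=.
under [RHS]eq_bigr do rewrite mxE raddf_sum /=.
by rewrite exchange_big; apply: eq_bigr => i _; apply: eq_bigr => j _; apply: qre_mulC.
Qed.

Lemma retrace1 n : retrace (1%:M : 'M[H]_n) = n%:R.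
Proof.
by rewrite /retrace mxtrace1 raddfMn.
Qed.

Lemma retrace_scale n (a : R) (Y : 'M[H]_n) :
  retrace ((quat_of_real a)%:M *m Y) = a * retrace Y.
Proof.
rewrite /retrace mul_scalar_mx /mxtrace !raddf_sum mulr_sumr /=.
by apply: eq_bigr => i _; rewrite mxE qre_real_mul.
Qed.

Section Rank.
Variables (m n : nat).
Implicit Types (N : 'M[H]_(m, n)) (S : {set 'I_n}).

Definition select_mx S : 'M[H]_n := \matrix_(x, y) ((x == y) && (x \in S))%:R.

Lemma mul_select_mx p (Y : 'M[H]_(p, n)) S i y :
  (Y *m select_mx S) i y = if y \in S then Y i y else 0.
Proof.
rewrite mxE (bigD1 y) //= big1 => [|x xy]; last by rewrite mxE (negbTE xy) mulr0.
by rewrite mxE eqxx addr0; case: (y \in S); rewrite ?mulr1 ?mulr0.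
Qed.

Lemma select_mx_mul p (Y : 'M[H]_(n, p)) S x j :
  (select_mx S *m Y) x j = if x \in S then Y x j else 0.
Proof.
rewrite mxE (bigD1 x) //= big1 => [|y xy]; last by rewrite mxE eq_sym (negbTE xy) mul0r.
by rewrite mxE eqxx addr0; case: (x \in S); rewrite ?mul1r ?mul0r.
Qed.

(** A nontrivial relation on [q |: S] must involve [q]; dividing on the right by its coefficient
    solves for that column. *)
Lemma right_indep_span N S q : right_indep N S -> ~ right_indep N (q |: S) ->
  exists c : 'I_n -> H, forall p, N p q = \sum_(x in S) N p x * c x.
Proof.
move=> indS depq.
have qS : q \notin S.
  by apply/negP => qS; apply: depq; rewrite (finset.setUidPr _) ?finset.sub1set.
have [c [Nc [y yS cy]]] : exists c : 'I_n -> H,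
    (forall p, \sum_(x in q |: S) N p x * c x = 0) /\
    exists2 y, y \in q |: S & c y != 0.
  apply: contrapT => h; apply: depq => c Nc y yS; apply/eqP.
  by apply: contraT => cy; case: h; exists c; split => //; exists y.
have eqn p : N p q * c q + \sum_(x in S) N p x * c x = 0.
  by rewrite -[RHS](Nc p) finset.big_setU1.
have cq : c q != 0.
  apply: contraNneq cy => cq0; apply/eqP; case/setU1P: yS => [-> //|].
  by apply: indS => p; have := eqn p; rewrite cq0 mulr0 add0r.
exists (fun x => - (c x * (c q)^-1)) => p.
under eq_bigr do rewrite mulrN mulrA.
have uq : c q \is a GRing.unit := cq.
by rewrite sumrN -mulr_suml -(addr0_eq (eqn p)) mulNr opprK mulrK.
Qed.

Lemma qrank_factor N : exists2 S : {set 'I_n}, right_indep N S &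
  #|S| = qrank N /\ exists C : 'M[H]_n, N = N *m select_mx S *m C.
Proof.
have ind0 : `[< right_indep N finset.set0 >].
  by apply/asboolP => c _ q; rewrite inE.
have [|S Sind rS] := @eq_bigmax_cond _ (fun S : {set 'I_n} => `[< right_indep N S >])
    (fun S => #|S|).
  by apply/card_gt0P; exists finset.set0.
have indS : right_indep N S by apply/asboolP.
exists S => //; split; first by rewrite -rS.
have span q : exists c : 'I_n -> H, forall p, N p q = \sum_(x in S) N p x * c x.
  case: (boolP (q \in S)) => qS.
    exists (fun x => (x == q)%:R) => p; rewrite (bigD1 q) //= eqxx mulr1.
    by rewrite big1 ?addr0 // => x /andP[_ /negbTE ->]; rewrite mulr0.
  apply: right_indep_span => // /asboolP indq.
  have := @leq_bigmax_cond _ (fun S : {set 'I_n} => `[< right_indep N S >])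
    (fun S => #|S|) _ indq.
  by rewrite rS cardsU1 qS add1n ltnn.
have [c cE] := choice span.
exists (\matrix_(x, q) c q x); apply/matrixP => p q; rewrite cE mxE [LHS]big_mkcond /=.
apply: eq_bigr => x _; rewrite mul_select_mx mxE.
by case: ifP => // _; rewrite mul0r.
Qed.

(* N W is an idempotent with the column space of N, so its trace is its rank. *)
Lemma retrace_proj_qrank N (W : 'M[H]_(n, m)) :
  N *m W *m N = N -> retrace (N *m W) = (qrank N)%:R.
Proof.
move=> NWN; have [S indS [rS [C NC]]] := qrank_factor N.
set E := select_mx S in NC.
have EE : E *m E = E.
  apply/matrixP => x y; rewrite mul_select_mx !mxE.
  have [->|] := eqVneq x y => //=; by case: (y \in S).
(* The difference [F] satisfies [E *m F = F] and [N *m F = 0], so its columns are relations among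
   the independent columns in [S]. *)
have key : E *m C *m W *m N *m E = E.
  apply/eqP; rewrite -subr_eq0; set F := _ - _; apply/eqP/matrixP => x y.
  have EF : E *m F = F by rewrite /F mulmxBr !mulmxA EE.
  have NF : N *m F = 0.
    by rewrite /F mulmxBr !mulmxA -NC NWN subrr.
  rewrite -EF select_mx_mul [RHS]mxE; case: ifP => // xS.
  apply: (indS (fun x => F x y)) => // p.
  transitivity ((N *m (E *m F)) p y); last by rewrite EF NF mxE.
  rewrite mxE big_mkcond /=; apply: eq_bigr => z _; rewrite select_mx_mul.
  by case: ifP; rewrite ?mulr0.
(* As [N = N E C], cyclicity turns the trace of [N W] into that of [E C W N E = E], which counts
   [S]. *)
rewrite {1}NC -EE -!mulmxA mulmxA retrace_mulC !mulmxA key.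
rewrite /retrace /mxtrace raddf_sum /= -rS -sum1_card natr_sum [RHS]big_mkcond /=.
by apply: eq_bigr => x _; rewrite mxE eqxx; case: (x \in S).
Qed.

End Rank.

Lemma qrank1 n : qrank (1%:M : 'M[H]_n) = n.
Proof.
apply/eqP; rewrite -(eqr_nat R) -(@retrace_proj_qrank _ _ 1%:M 1%:M) ?mulmx1 //.
by rewrite retrace1.
Qed.

Section Hermitian.
Variables (n : nat) (A : 'M[H]_n).
Hypothesis hA : is_hermitian A.

Lemma hermitian_entry i j : qconj (A i j) = A j i.
Proof. by rewrite -{2}hA !mxE. Qed.

Lemma hermitianX l : is_hermitian (A ^+ l).
Proof.
elim: l => [|l IH].
  apply/matrixP => i j; rewrite !mxE eq_sym.
  by case: (i == j); apply: quat_ext => //=; ring.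
by rewrite /is_hermitian {1}exprS -mulmxE ctrmxM IH hA mulmxE -exprSr.
Qed.

(** The exponent descends to 1: for [Z = Y *m A ^+ l.+1], the product [Z *m ctrmx Z] has the left
    factor [Y *m A ^+ l.+2], so it vanishes with that factor. *)
Lemma hermitian_mulX_eq0 (Y : 'M[H]_n) l : Y *m A ^+ l = 0 -> Y *m A = 0.
Proof.
elim: l => [|[|l] IH]; first by rewrite expr0 mulmx1 => ->; rewrite mul0mx.
  by rewrite expr1.
move=> h; apply: IH; apply: ctrmx_mul_eq0.
rewrite ctrmxM hermitianX mulmxA -(mulmxA Y) mulmxE -exprD addnS -addSn exprD -mulmxE.
by rewrite mulmxA h !mul0mx.
Qed.

End Hermitian.

End Quaternions.

(** * Principal submatrices and the Drazin inverse *)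

Section IncreasingSequences.
Variables (s n : nat).
Implicit Types (b : {ffun 'I_s -> 'I_n}) (S : {set 'I_n}).

Definition seq_support b : {set 'I_n} := b @: [set: 'I_s].

Lemma Jset_mono b : b \in Jset s n -> forall p q : 'I_s, (p < q)%N -> (b p < b q)%N.
Proof. by rewrite inE => /forallP h p q; have /forallP/(_ q)/implyP := h p; apply. Qed.

Lemma mem_seq_support b i : (i \in seq_support b) = (i \in codom b).
Proof. by apply/imsetP/codomP => [[p _ ->]|[p ->]]; exists p. Qed.

(** Strictly increasing lists with the same members are equal. *)
Lemma seq_support_inj : {in Jset s n &, injective seq_support}.
Proof.
move=> b c /Jset_mono hb /Jset_mono hc bc.
have codomE : codom b = codom c.
  apply: (@irr_sorted_eq _ (fun x y : 'I_n => (x < y)%N)).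
  - by move=> y x z; apply: ltn_trans.
  - by move=> x; apply: ltnn.
  - by apply: homo_sorted (sorted_enum_ord s) => p q; apply: hb.
  - by apply: homo_sorted (sorted_enum_ord s) => p q; apply: hc.
  - by move=> x; rewrite -!mem_seq_support bc.
apply/ffunP => p; have := congr1 (fun l => nth (b p) l (enum_rank p)) codomE.
by rewrite !nth_codom enum_rankK.
Qed.

Lemma imset_seq_support : [set seq_support b | b in Jset s n] = [set S : {set 'I_n} | #|S| == s].
Proof.
apply/setP => S; rewrite inE; apply/imsetP/eqP => [[b /Jset_mono hb ->]|hS].
  by rewrite card_imset ?cardsT ?card_ord //; apply: mono_ord_inj.
pose b := [ffun p : 'I_s => enum_val (cast_ord (esym hS) p)].
have sS : sorted (fun c d : 'I_n => (c < d)%N) (enum S).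
  rewrite /enum_mem; apply: sorted_filter; first by move=> y x z; apply: ltn_trans.
  by have := sorted_enum_ord n; rewrite enumT.
exists b.
  rewrite inE; apply/forallP => p; apply/forallP => q; apply/implyP => pq.
  rewrite !ffunE !(enum_val_nth (b p)).
  apply: (sorted_ltn_nth _ _ sS) => //=; first by move=> y x z; apply: ltn_trans.
    by rewrite inE -cardE hS.
  by rewrite inE -cardE hS.
apply/setP => x; rewrite mem_seq_support; apply/idP/codomP => [xS|[p ->]].
  exists (cast_ord hS (enum_rank_in xS x)).
  by rewrite ffunE cast_ordK enum_rankK_in.
by rewrite ffunE; apply: enum_valP.
Qed.

Lemma sum_Jset (V : nmodType) (P : pred {set 'I_n}) (F : {set 'I_n} -> V) :
  \sum_(b in Jset s n | P (seq_support b)) F (seq_support b) =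
  \sum_(S : {set 'I_n} | (#|S| == s) && P S) F S.
Proof.
rewrite big_mkcondr -(big_imset (fun S => if P S then F S else 0) seq_support_inj) /=.
by rewrite imset_seq_support -big_mkcondr /=; apply: eq_bigl => S; rewrite inE.
Qed.

End IncreasingSequences.

Section PrincipalMinors.
Variables (R : realType) (n s : nat) (M : 'M[quat R]_n).
Implicit Types (b : {ffun 'I_s -> 'I_n}).

(** All column determinants of the submatrix are diagonal entries of one scalar matrix, so the real
    number that [hdet] selects exists. *)
Lemma hdet_prinmx b : is_hermitian M -> (0 < s)%N -> b \in Jset s n ->
  quat_of_real (hdet (prinmx M b)) = sdet M (seq_support b).
Proof.
move=> hM s0 /Jset_mono hb.
have hN : is_hermitian (prinmx M b).
  by apply/matrixP => p q; rewrite !mxE (hermitian_entry hM).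
have [cN eN] := herm_cofactors (@qconjM R) (@qconjK R) (@qconj_central R)
  (hermitian_entry hN) [set: 'I_s].
have detN j : cdet j (prinmx M b) = sdet M (seq_support b).
  rewrite cdetE sub_cdet_expand ?inE // eN ?inE // eqxx.
  by apply: sdet_relabel => // x y _ _; rewrite mxE.
have detR : sdet M (seq_support b) = quat_of_real (qre (sdet M (seq_support b))).
  by apply: qconj_fixed; rewrite -(detN (Ordinal s0)) cdetE sub_cdet_expand ?inE // eN ?inE // eqxx.
have ex : exists d : R, forall j, cdet j (prinmx M b) = quat_of_real d.
  by exists (qre (sdet M (seq_support b))) => j; rewrite detN.
(* A column is needed to pin the value down: for [s = 0] every real would qualify. *)
by have := xgetPex 0 ex (Ordinal s0); rewrite detN.
Qed.

(** Replacing column [i] changes only the closing entries of the expansion. *)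
Lemma cdet_prin_replace_col b i (c : 'cV[quat R]_n) : b \in Jset_at s i ->
  cdet_prin i (replace_col M i c) b =
  \sum_(x in seq_support b) path_det M (seq_support b) i x * c x ord0.
Proof.
rewrite inE => /andP[/Jset_mono hb /codomP[p ip]].
have binj := mono_ord_inj hb.
rewrite /cdet_prin; case: pickP => [q /eqP bq|/(_ p)]; last by rewrite ip eqxx.
have {bq q} -> : q = p by apply: binj; rewrite bq.
rewrite cdetE sub_cdet_expand ?inE // /seq_support big_imset /=; last first.
  by move=> x y _ _; apply: binj.
apply: eq_big => x; rewrite ?inE // => _; rewrite !mxE ip eqxx; congr (_ * _).
apply: path_det_relabel; rewrite ?inE // => u v _ _ vp.
by rewrite !mxE (inj_eq binj) (negbTE vp).
Qed.

End PrincipalMinors.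

Lemma is_Ind_uniq (R : realType) n (A : 'M[quat R]_n) k l :
  is_Ind A k -> is_Ind A l -> k = l.
Proof.
by move=> [rk mk] [rl ml]; apply/eqP; rewrite eqn_leq mk ?ml.
Qed.

(** Both equal [X * A * Y]: powers of the idempotents [X * A] and [A * Y] bring in [A ^+ k], which
    is traded for [A ^+ k.+1] times the other inverse. *)
Lemma is_drazin_uniq (R : realType) n (A X Y : 'M[quat R]_n) :
  is_drazin A X -> is_drazin A Y -> X = Y.
Proof.
move=> [k [ik AX XAX cX]] [l [il AY YAY cY]].
move: AY; rewrite -{il}(is_Ind_uniq ik il) => {l} AY.
rewrite !mulmxE in AX XAX cX AY YAY cY.
have eX l : X = X * (X * A) ^+ l.
  by elim: l => [|l IH]; rewrite ?expr0 ?mulr1 // exprSr mulrA -IH -cX mulrA.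
have eY l : Y = (A * Y) ^+ l * Y.
  by elim: l => [|l IH]; rewrite ?expr0 ?mul1r // exprS -mulrA -IH cY.
have iX : X * A * (X * A) = X * A by rewrite mulrA XAX.
have iY : A * Y * (A * Y) = A * Y by rewrite -mulrA (mulrA Y) YAY.
have pX : (X * A) ^+ k.+1 = X * A.
  by elim: k {ik AX AY} => [|k IH]; rewrite ?expr1 // exprS IH.
have pY : (A * Y) ^+ k.+1 = A * Y.
  by elim: k {ik AX AY pX} => [|k IH]; rewrite ?expr1 // exprS IH.
transitivity (X * A * Y).
  rewrite {1}(eX k) exprMn_comm; last exact: esym cX.
  by rewrite -AY !mulrA -exprS -mulrA mulrA -exprMn_comm ?pX //; exact: esym cX.
rewrite {2}(eY k) exprMn_comm // -AX -(commrX k.+1 (esym cX)).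
by rewrite -!mulrA -exprSr -exprMn_comm // pY mulrA.
Qed.

(** * The Drazin inverse from sums of principal minors *)

Section DrazinInverse.
Variables (R : realType) (n k : nat) (A : 'M[quat R]_n).
Hypothesis hA : is_hermitian A.
Local Notation M := (A ^+ k.+1).
Local Notation entryM := (hermitian_entry (hermitianX hA k.+1)).

Let adjS s : adj_sum M s.+1 = (minor_sum M s)%:M - adj_sum M s *m M :=
  adj_sumS (@qconjM R) (@qconjK R) (@qconj_central R) entryM s.

Let adj_commA s : adj_sum M s *m A = A *m adj_sum M s.
Proof.
apply: (adj_sum_comm (@qconjM R) (@qconjK R) (@qconj_central R) entryM).
by rewrite !mulmxE -exprSr -exprS.
Qed.

Let adj_commM s : adj_sum M s *m M = M *m adj_sum M s.
Proof. exact: (adj_sum_comm (@qconjM R) (@qconjK R) (@qconj_central R) entryM). Qed.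

Definition scaled_adj s (c : R) : 'M[quat R]_n :=
  (quat_of_real c^-1)%:M *m adj_sum M s.

Lemma mul_scaled_adj s c : c != 0 -> minor_sum M s = quat_of_real c ->
  M *m scaled_adj s c = 1%:M - (quat_of_real c^-1)%:M *m adj_sum M s.+1.
Proof.
move=> c0 cE.
rewrite mulmxA (scalar_mx_fixedC (@qconj_central R) _ (qconj_real _)) -mulmxA -adj_commM.
have -> : adj_sum M s *m M = (quat_of_real c)%:M - adj_sum M s.+1.
  by rewrite adjS cE opprB addrC subrK.
rewrite mulmxBr -scalar_mxM -quat_of_realV mulVr //.
by rewrite -[_ \is a _]/(_ != 0) quat_of_real_eq0.
Qed.

Lemma minor_sum_rank : exists c : R,
  [/\ minor_sum M (qrank M) = quat_of_real c, c != 0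
    & adj_sum M (qrank M).+1 *m A = 0].
Proof.
(* The minor sum of index 0 is 1, so a largest index with nonzero minor sum exists. *)
have ex : exists s, (s <= n)%N && (minor_sum M s != 0).
  by exists 0%N; rewrite minor_sum0 oner_neq0.
have bound s : (s <= n)%N && (minor_sum M s != 0) -> (s <= n)%N by case/andP.
case: (ex_maxnP ex bound) => s /andP[sn es] smax.
(* Past [s] the recursion reads [adj_sum M u.+1 = - adj_sum M u *m M], so factors [M] raise the
   index up to [adj_sum M n.+1 = 0]. *)
have vanish d u : (u + d)%N = n.+1 -> (s < u)%N -> adj_sum M u *m M ^+ d = 0.
  elim: d u => [|d IH] u; first by rewrite addn0 => -> _; rewrite adj_sum_max mul0mx.
  rewrite addnS => -[ud] su.
  have eu : minor_sum M u = 0.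
    apply/eqP; apply: contraLR su => eu; rewrite -leqNgt; apply: smax.
    by rewrite eu andbT -ud leq_addr.
  have e : adj_sum M u *m M = - adj_sum M u.+1.
    by rewrite adjS eu raddf0 sub0r opprK.
  rewrite (exprS M) -mulmxE mulmxA e mulNmx IH ?oppr0 //; first by rewrite addSn ud.
  exact: ltnW.
(* [M ^+ (n - s)] is a power of the Hermitian [A], so one factor [A] already gives 0. *)
have PA : adj_sum M s.+1 *m A = 0.
  apply: (hermitian_mulX_eq0 hA (l := (k.+1 * (n - s))%N)).
  by rewrite exprM vanish // addSn subnKC.
have PM : adj_sum M s.+1 *m M = 0.
  by rewrite [X in _ *m X]exprS -mulmxE mulmxA PA mul0mx.
pose c := qre (minor_sum M s).
have cE : minor_sum M s = quat_of_real c.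
  by apply: qconj_fixed; exact: (conj_minor_sum (@qconjM R) (@qconjK R) (@qconj_central R) entryM).
have c0 : c != 0 by rewrite -quat_of_real_eq0 -cE.
suff rs : qrank M = s by rewrite rs; exists c.
have MW := mul_scaled_adj c0 cE.
(* [scaled_adj s c] is an inner inverse of [M], so the rank is the real trace of their product,
   [n - (n - s) * c / c = s]. *)
apply/eqP; rewrite -(eqr_nat R) -(@retrace_proj_qrank _ _ _ M (scaled_adj s c)); last first.
  by rewrite MW mulmxBl mul1mx -mulmxA PM mulmx0 subr0.
rewrite MW retraceB retrace1 retrace_scale /retrace mxtrace_adj_sum raddfMn /=.
by rewrite -/c mulrnAr mulVf // natrB // opprB addrC subrK.
Qed.

(** [W] inverts [M] on the column space of [A ^+ k] and commutes with [A]; the three Drazin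
    equations follow. *)
Lemma drazin_scaled_adj c : is_Ind A k -> qrank (A ^+ k) = qrank M ->
  c != 0 -> minor_sum M (qrank M) = quat_of_real c ->
  drazin A = scaled_adj (qrank M) c *m A ^+ k.
Proof.
move=> ik rk c0 cE; set W := scaled_adj _ _.
have MW := mul_scaled_adj c0 cE.
have PAk : adj_sum M (qrank M).+1 *m A ^+ k = 0.
  have [_ [_ _ PA]] := minor_sum_rank.
  (* For [k = 0] there is no factor [A] to use, but then the rank is [n] and [adj_sum M n.+1] is
     zero. *)
  have [k0|k_gt0] := posnP k; last first.
    have -> : A ^+ k = A *m A ^+ k.-1 by rewrite mulmxE -exprS prednK.
    by rewrite mulmxA PA mul0mx.
  have rn : qrank M = n by rewrite -rk k0; apply: qrank1.
  by rewrite rn adj_sum_max mul0mx.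
have MWAk : M *m W *m A ^+ k = A ^+ k.
  by rewrite MW mulmxBl mul1mx -mulmxA PAk mulmx0 subr0.
have WA : W *m A = A *m W.
  rewrite /W -mulmxA adj_commA !mulmxA.
  by rewrite (scalar_mx_fixedC (@qconj_central R) _ (qconj_real _)).
have h : is_drazin A (W *m A ^+ k).
  exists k; split=> //; first by rewrite mulmxA.
    have e : A ^+ k *m A = M by rewrite mulmxE -exprSr.
    by rewrite -(mulmxA W _ A) e -!(mulmxA W) (mulmxA M) MWAk.
  by rewrite mulmxA -WA -!mulmxA !mulmxE -exprS -exprSr.
apply: (is_drazin_uniq _ h); rewrite /drazin; apply: xgetPex.
by exists (W *m A ^+ k).
Qed.

End DrazinInverse.

Theorem theorem4p1 (R : realType) (n m k r : nat)
    (A : 'M[quat R]_n) (B : 'M[quat R]_(n, m))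
    (hA : is_hermitian A) (hk : is_Ind A k)
    (hrk1 : qrank (A ^+ k.+1) = r) (hrk : qrank (A ^+ k) = r)
    (hr1 : (1 <= r)%N) (hrn : (r <= n)%N) :
  let Bhat : 'M[quat R]_(n, m) := A ^+ k *m B in
  let X : 'M[quat R]_(n, m) := drazin A *m B in
  let D : R := \sum_(b in Jset r n) hdet (prinmx (A ^+ k.+1) b) in
  D != 0 /\
  forall (i : 'I_n) (j : 'I_m),
    X i j =
      (\sum_(b in Jset_at r i)
          cdet_prin i (replace_col (A ^+ k.+1) i (col j Bhat)) b)
      / quat_of_real D.
Proof.
move=> Bhat X D.
have [c [cE c0 _]] := minor_sum_rank k hA.
have DE : D = c.
  apply/eqP; rewrite -subr_eq0 -quat_of_real_eq0 raddfB subr_eq0 /=; apply/eqP.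
  rewrite -cE hrk1 raddf_sum /minor_sum /=.
  transitivity (\sum_(b in Jset r n | predT (seq_support b)) sdet (A ^+ k.+1) (seq_support b)).
    apply: eq_big => [b|b bJ]; first by rewrite andbT.
    by apply: hdet_prinmx => //; apply: hermitianX.
  by rewrite sum_Jset; apply: eq_bigl => S; rewrite andbT.
rewrite DE; split=> // i j.
have XE : X = (quat_of_real c^-1)%:M *m (adj_sum (A ^+ k.+1) r *m Bhat).
  by rewrite /X (drazin_scaled_adj hA hk _ c0 cE) ?hrk1 // /scaled_adj !mulmxA.
rewrite XE mul_scalar_mx mxE quat_of_realV (qconj_central (qconj_real _)); congr (_ * _).
rewrite mxE.
(* Exchanging the sums over [x] and over index sets turns the entry of the product into a sum of
   expanded column determinants. *)
transitivity (\sum_(b in Jset r n | i \in seq_support b)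
  \sum_(x in seq_support b) path_det (A ^+ k.+1) (seq_support b) i x * Bhat x j).
  rewrite (sum_Jset _ (fun S : {set 'I_n} => i \in S)
    (fun S => \sum_(x in S) path_det (A ^+ k.+1) S i x * Bhat x j)).
  under eq_bigr do rewrite mxE mulr_suml.
  rewrite (exchange_big_dep (fun S : {set 'I_n} => (#|S| == r) && (i \in S))) /=; last first.
    by move=> x S _ /and3P[-> ->].
  by apply: eq_bigr => S /andP[-> ->]; apply: eq_bigl.
apply: eq_big => [b|b bJ]; first by rewrite [RHS]inE mem_seq_support.
rewrite cdet_prin_replace_col; last by rewrite inE -mem_seq_support.
by apply: eq_bigr => x _; rewrite [col j Bhat x ord0]mxE.
Qed.
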